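(* Let $\mathcal{H}$ be a separable infinite-dimensional complex Hilbert space, let $d, I, J$ be positive integers, let $\delta \in M_{I\times J}(\mathbb{C}\langle x_1,\ldots,x_d\rangle)$ be an $I\times J$ matrix of noncommutative polynomials in $d$ variables, and let $$B_{\delta}(\mathcal{B}(\mathcal{H}))=\{X\in \mathcal{B}(\mathcal{H})^d : \Vert\delta(X)\Vert<1\}.$$ Then every operator NC function $\varphi : B_{\delta}(\mathcal{B}(\mathcal{H})) \rightarrow \mathcal{B}(\mathcal{H})$ is weakly algebraic; that is, for every $Z\in B_{\delta}(\mathcal{B}(\mathcal{H}))$, $$\varphi(Z)\in \overline{\operatorname{Alg}(Z)}^{\,WOT}.$$
   Context: $\mathcal{B}(\mathcal{H})$ is the algebra of bounded linear operators on $\mathcal{H}$, and $\mathcal{H}^{(n)}$ denotes the Hilbert space direct sum of $n$ copies of $\mathcal{H}$. Elements of $\mathcal{B}(\mathcal{H})^d$ are $d$-tuples $X=(X^1,\ldots,X^d)$. Evaluation: for $\delta=(\delta_{ij})\in M_{I\times J}(\mathbb{C}\langle x_1,\ldots,x_d\rangle)$ (entries in the free unital algebra on $d$ generators, i.e. polynomials in $d$ noncommuting variables) and $X\in\mathcal{B}(\mathcal{H})^d$, $\delta(X)$ is the operator matrix $(\delta_{ij}(X))$, regarded as an element of $\mathcal{B}(\mathcal{H}^{(J)},\mathcal{H}^{(I)})$; $\Vert\delta(X)\Vert$ is its operator norm. Direct sums and conjugations of tuples are componentwise: for $X,Y\in\mathcal{B}(\mathcal{H})^d$ and a bounded invertible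 $s:\mathcal{H}\to\mathcal{H}^{(2)}$, $s^{-1}\begin{bmatrix} X&0\\0&Y\end{bmatrix}s$ is the tuple in $\mathcal{B}(\mathcal{H})^d$ with $i$-th coordinate $s^{-1}\begin{bmatrix} X^i&0\\0&Y^i\end{bmatrix}s$. Operator NC function: with $\Sigma=B_\delta(\mathcal{B}(\mathcal{H}))$, a function $f:\Sigma\to\mathcal{B}(\mathcal{H})$ is an operator NC function if whenever $X,Y\in\Sigma$ and $s:\mathcal{H}\to\mathcal{H}^{(2)}$ is bounded and invertible (with bounded inverse) such that $s^{-1}\begin{bmatrix} X&0\\0&Y\end{bmatrix}s\in\Sigma$, then $$f\left(s^{-1}\begin{bmatrix} X&0\\0&Y\end{bmatrix}s\right)=s^{-1}\begin{bmatrix} f(X)&0\\0&f(Y)\end{bmatrix}s.$$ No continuity or boundedness of $f$ is assumed. For $Z\in\mathcal{B}(\mathcal{H})^d$, $\operatorname{Alg}(Z)$ is the unital subalgebra of $\mathcal{B}(\mathcal{H})$ generated by the coordinates $Z^1,\ldots,Z^d$ (adjoints not included), and $\overline{\,\cdot\,}^{\,WOT}$ denotes closure in the weak operator topology of $\mathcal{B}(\mathcal{H})$. *)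

(* Defs.v *)
From HB Require Import structures.
From mathcomp Require Import all_boot all_order all_algebra.
From mathcomp Require Import sesquilinear spectral complex finmap.
From mathcomp Require Import all_classical all_reals all_analysis.
(* The notations of [monalg] clash with those of MathComp-Analysis. *)
From mathcomp Require Import -(notations) monalg.

Set Implicit Arguments.
Unset Strict Implicit.
Unset Printing Implicit Defensive.

Import Order.TTheory GRing.Theory Num.Theory numFieldNormedType.Exports.

Local Open Scope classical_set_scope.
Local Open Scope ring_scope.

(* The inner product is linear in its first argument. *)
HB.mixin Record CompleteNormedModule_isHilbert (R : realType) H
    of CompleteNormedModule R[i] H := {
  inner : {dot H for Num.conj};
  normr_inner : forall x : H, `|x| ^+ 2 = inner x x
}.

#[short(type="hilbertType")]
HB.structure Definition Hilbert (R : realType) :=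
  {H of CompleteNormedModule R[i] H & CompleteNormedModule_isHilbert R H}.

Definition separable (T : topologicalType) :=
  exists A : set T, countable A /\ dense A.

Definition infinite_dimensional (K : fieldType) (V : lmodType K) :=
  ~ exists (n : nat) (e : 'I_n -> V),
      forall v, exists c : 'I_n -> K, v = \sum_i c i *: e i.

Section BoundedOperators.
Context {K : numFieldType}.

Definition bounded_op_pred (U V : normedModType K) : {pred U -> V} :=
  [pred f | `[< linear f /\ continuous f >]].

Record bounded_op (U V : normedModType K) := BoundedOp {
  bounded_op_fun :> U -> V;
  bounded_op_subproof : bounded_op_fun \in @bounded_op_pred U V
}.

HB.instance Definition _ (U V : normedModType K) :=
  [isSub of bounded_op U V for @bounded_op_fun U V].
HB.instance Definition _ (U V : normedModType K) :=
  [Choice of bounded_op U V by <:].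

Lemma bounded_opP (U V : normedModType K) (f : U -> V) :
  reflect (linear f /\ continuous f) (f \in @bounded_op_pred U V).
Proof. exact: asboolP. Qed.

Lemma bounded_op_linear (U V : normedModType K) (T : bounded_op U V) :
  linear T.
Proof. by have /bounded_opP[] := valP T. Qed.

Lemma bounded_op_continuous (U V : normedModType K) (T : bounded_op U V) :
  continuous T.
Proof. by have /bounded_opP[] := valP T. Qed.

HB.instance Definition _ (U V : normedModType K) (T : bounded_op U V) :=
  GRing.isLinear.Build K U V *:%R T (bounded_op_linear T).

Lemma bounded_op_submod_closed (U V : normedModType K) :
  GRing.submod_closed (@bounded_op_pred U V).
Proof.
split=> [|a f g /bounded_opP[lf cf] /bounded_opP[lg cg]].
  apply/bounded_opP; split=> [a x y|]; last exact: cst_continuous.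
  by rewrite [RHS]addr0 scaler0.
apply/bounded_opP; split=> [b x y|x].
  rewrite [LHS](_ : _ = a *: f (b *: x + y) + g (b *: x + y)) // lf lg.
  rewrite [RHS](_ : _ = b *: (a *: f x + g x) + (a *: f y + g y)) //.
  by rewrite !scalerDr !scalerA mulrC addrACA.
by apply: cvgD (cg x); apply: cvgZl_tmp; exact: cf.
Qed.

HB.instance Definition _ (U V : normedModType K) :=
  GRing.isSubmodClosed.Build K (U -> V)
    (@bounded_op_pred U V) (bounded_op_submod_closed U V).
HB.instance Definition _ (U V : normedModType K) :=
  [SubChoice_isSubLmodule of bounded_op U V by <:].

Lemma bounded_op_eqP (U V : normedModType K) (S T : bounded_op U V) :
  S =1 T <-> S = T.
Proof. by split=> [/funext/val_inj|->]. Qed.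

Lemma bounded_op_sumE (U V : normedModType K) (I : finType)
    (F : I -> bounded_op U V) x : (\sum_i F i) x = \sum_i F i x.
Proof. by elim/big_rec2: _ => //= i y T _ <-. Qed.

Fact bounded_op_comp_subproof (U V W : normedModType K)
    (S : bounded_op V W) (T : bounded_op U V) :
  S \o T \in @bounded_op_pred U W.
Proof.
apply/bounded_opP; split=> [a x y|x] /=; first by rewrite !linearP.
by apply: continuous_comp; exact: bounded_op_continuous.
Qed.

Definition bounded_op_comp (U V W : normedModType K)
    (S : bounded_op V W) (T : bounded_op U V) : bounded_op U W :=
  BoundedOp (bounded_op_comp_subproof S T).

Fact bounded_op_id_subproof (V : normedModType K) :
  id \in @bounded_op_pred V V.
Proof. by apply/bounded_opP; split=> // x; exact: cvg_id. Qed.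

Definition bounded_op_id (V : normedModType K) : bounded_op V V :=
  BoundedOp (bounded_op_id_subproof V).

End BoundedOperators.

Notation "''B' ( H )" := (bounded_op H H)
  (at level 8, format "''B' ( H )") : type_scope.

(* Multiplication in 'B(V) is composition. *)
Section BoundedOperatorRing.
Context {K : numFieldType} (V : normedModType K).

Let compA : associative (@bounded_op_comp K V V V).
Proof. by move=> S T U; apply/bounded_op_eqP. Qed.

Let comp1o : left_id (bounded_op_id V) (@bounded_op_comp K V V V).
Proof. by move=> T; apply/bounded_op_eqP. Qed.

Let compo1 : right_id (bounded_op_id V) (@bounded_op_comp K V V V).
Proof. by move=> T; apply/bounded_op_eqP. Qed.

Let compDl : left_distributive (@bounded_op_comp K V V V) +%R.
Proof. by move=> S T U; apply/bounded_op_eqP. Qed.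

Let compDr : right_distributive (@bounded_op_comp K V V V) +%R.
Proof.
move=> S T U; apply/bounded_op_eqP => x.
exact: (raddfD S (T x) (U x)).
Qed.

HB.instance Definition _ := GRing.Zmodule_isPzRing.Build 'B(V)
  compA comp1o compo1 compDl compDr.

End BoundedOperatorRing.

(* The Hilbert space direct sum of n copies of V. *)
Definition copies (n : nat) (V : Type) : Type := 'I_n -> V.

Section Copies.
Context {C : numClosedFieldType} (n : nat) (V : normedModType C).

HB.instance Definition _ := GRing.Lmodule.copy (copies n V) ('I_n -> V).

Definition l2norm (x : copies n V) : C := sqrtC (\sum_i `|x i| ^+ 2).

Let sum_ge0 (x : copies n V) : 0 <= \sum_i `|x i| ^+ 2.
Proof. by apply: sumr_ge0 => i _; rewrite exprn_ge0. Qed.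

Fact l2normD x y : l2norm (x + y) <= l2norm x + l2norm y.
Proof.
pose u (z : copies n V) : 'rV[C]_n := \row_i `|z i|.
have dotE (v : 'rV[C]_n) : (forall i, 0 <= v 0 i) ->
    dotmx v v = \sum_i v 0 i ^+ 2.
  move=> v0; rewrite dotmxE mxE; apply: eq_bigr => i _.
  by rewrite !mxE conj_Creal ?expr2 // ger0_real.
have u0 z i : 0 <= u z 0 i by rewrite mxE.
have l2E z : l2norm z = sqrtC (dotmx (u z) (u z)).
  by rewrite dotE //; congr sqrtC; apply: eq_bigr => i _; rewrite mxE.
rewrite [l2norm x]l2E [l2norm y]l2E.
have leD : sqrtC (dotmx (u x + u y) (u x + u y)) <=
    sqrtC (dotmx (u x) (u x)) + sqrtC (dotmx (u y) (u y)).
  exact: (triangle_lerif (@dotmx C n) (u x) (u y)).1.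
apply: le_trans leD; rewrite dotE; last by move=> i; rewrite mxE addr_ge0 ?u0.
rewrite ler_sqrtC ?nnegrE ?sum_ge0 //; last first.
  by apply: sumr_ge0 => i _; rewrite exprn_ge0 // mxE addr_ge0.
apply: ler_sum => i _; rewrite !mxE lerXn2r ?nnegrE ?addr_ge0 //.
exact: ler_normD.
Qed.

Fact l2normZ (a : C) x : l2norm (a *: x) = `|a| * l2norm x.
Proof.
rewrite /l2norm -[X in X * _]sqrCK ?normr_ge0 // -sqrtCM ?nnegrE ?exprn_ge0 //.
rewrite mulr_sumr; congr sqrtC; apply: eq_bigr => i _.
by rewrite -exprMn -normrZ.
Qed.

Fact l2norm_eq0 x : l2norm x = 0 -> x = 0.
Proof.
move/eqP; rewrite sqrtC_eq0 psumr_eq0 => [|i _]; last by rewrite exprn_ge0.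
move/allP => x0; apply/funext => i; apply/eqP.
by rewrite -normr_eq0 -sqrf_eq0; exact: (implyP (x0 i (mem_index_enum i))).
Qed.

HB.instance Definition _ :=
  Lmodule_isNormed.Build C (copies n V) l2normD l2normZ l2norm_eq0.

Lemma copies_normE (x : copies n V) : `|x| = sqrtC (\sum_i `|x i| ^+ 2).
Proof. by []. Qed.

Lemma copies_coord_le (x : copies n V) i : `|x i| <= `|x|.
Proof.
rewrite copies_normE -[X in X <= _]sqrCK ?normr_ge0 //.
have x0 (P : pred 'I_n) : 0 <= \sum_(j | P j) `|x j| ^+ 2.
  by apply: sumr_ge0 => j _; rewrite exprn_ge0.
rewrite ler_sqrtC ?nnegrE ?exprn_ge0 ?x0 // (bigD1 i) //=.
by rewrite lerDl x0.
Qed.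

Lemma copies_norm_le (x : copies n V) : `|x| <= \sum_i `|x i|.
Proof.
have s0 (P : pred 'I_n) : 0 <= \sum_(j | P j) `|x j|.
  by apply: sumr_ge0 => j _.
rewrite copies_normE -[X in _ <= X]sqrCK ?s0 //.
rewrite ler_sqrtC ?nnegrE ?exprn_ge0 ?s0 //.
rewrite [X in _ <= X]expr2 mulr_suml; apply: ler_sum => i _.
rewrite expr2 ler_wpM2l // (bigD1 i) //=.
by rewrite lerDl s0.
Qed.

End Copies.

Section OperatorMatrices.
Context {C : numClosedFieldType} (V W : normedModType C).

Lemma contractive_bounded_op (U1 U2 : normedModType C) (f : U1 -> U2) :
  linear f -> (forall x, `|f x| <= `|x|) -> f \in @bounded_op_pred C U1 U2.
Proof.
move=> lf f1; apply/bounded_opP; split=> //.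
pose g : {linear U1 -> U2} := HB.pack f (GRing.isLinear.Build _ _ _ _ f lf).
apply: (@bounded_linear_continuous _ _ _ g); apply/linear_boundedP.
exists 1; split=> [|r /ltW r1 x]; first exact: real1.
by rewrite (le_trans (f1 x)) // ler_peMl.
Qed.

Lemma coord_bounded_op n (j : 'I_n) :
  (fun x : copies n V => x j) \in @bounded_op_pred C (copies n V) V.
Proof. by apply: contractive_bounded_op => // x; exact: copies_coord_le. Qed.

Lemma inj_bounded_op m (i : 'I_m) :
  (fun (w : W) k => if k == i then w else 0) \in
    @bounded_op_pred C W (copies m W).
Proof.
apply: contractive_bounded_op => [a x y|x].
  apply/funext => k; rewrite [RHS](_ : _ = a *: (if k == i then x else 0) +
    (if k == i then y else 0)) //.
  by case: ifP => _; rewrite ?scaler0 ?addr0.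
apply: le_trans (copies_norm_le _) _.
rewrite (bigD1 i) //= eqxx big1 ?addr0 // => k /negbTE ->.
exact: normr0.
Qed.

Fact op_matrix_subproof m n (A : 'M[bounded_op V W]_(m, n)) :
  (fun (x : copies n V) i => \sum_j A i j (x j) : W) \in
    @bounded_op_pred C (copies n V) (copies m W).
Proof.
pose T : bounded_op (copies n V) (copies m W) := \sum_i \sum_j
  bounded_op_comp (BoundedOp (inj_bounded_op i))
    (bounded_op_comp (A i j) (BoundedOp (coord_bounded_op j))).
suff -> : (fun x i => \sum_j A i j (x j)) = T by exact: valP.
apply/funext => x; rewrite bounded_op_sumE; apply/funext => k.
rewrite fct_sumE (bigD1 k) //= [X in _ + X]big1 ?addr0 => [|i ik].
  rewrite bounded_op_sumE fct_sumE; apply: eq_bigr => j _ /=.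
  by rewrite eqxx.
rewrite bounded_op_sumE fct_sumE big1 // => j _ /=.
by rewrite eq_sym (negbTE ik).
Qed.

Definition op_matrix m n (A : 'M[bounded_op V W]_(m, n)) :
    bounded_op (copies n V) (copies m W) :=
  BoundedOp (op_matrix_subproof A).

End OperatorMatrices.

Definition diag2 {C : numClosedFieldType} {V : normedModType C}
    (X Y : 'B(V)) : 'B(copies 2 V) :=
  op_matrix (\matrix_(i < 2, j < 2)
    if i != j then 0 else if i == 0 then X else Y).

Definition opnorm {R : realType} {U V : normedModType R[i]}
    (T : bounded_op U V) : R :=
  sup [set complex.Re `|T x| | x in [set x : U | `|x| <= 1]].

(* The free algebra, as the algebra of the free monoid of words in 'I_d. *)
Definition nc_poly (K : comNzRingType) (d : nat) : Type :=
  malg (fmonom 'I_d) K.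
HB.instance Definition _ (K : comNzRingType) (d : nat) :=
  GRing.Lalgebra.on (nc_poly K d).

Definition nc_eval {K : numFieldType} {V : normedModType K} (d : nat)
    (X : 'I_d -> 'B(V)) (p : nc_poly K d) : 'B(V) :=
  \sum_(w <- msupp p) mcoeff w p *: \prod_(i <- fmonom_val w) X i.

Definition nc_eval_mx {C : numClosedFieldType} {V : normedModType C}
    (d m n : nat) (delta : 'M[nc_poly C d]_(m, n)) (X : 'I_d -> 'B(V)) :
    bounded_op (copies n V) (copies m V) :=
  op_matrix (map_mx (nc_eval X) delta).

Section OperatorNC.
Context {R : realType} (H : hilbertType R) (d : nat).

Definition nc_ball (m n : nat) (delta : 'M[nc_poly R[i] d]_(m, n)) :
    set ('I_d -> 'B(H)) :=
  [set X | opnorm (nc_eval_mx delta X) < 1].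

Definition conj_diag2 (s : bounded_op H (copies 2 H))
    (s' : bounded_op (copies 2 H) H) (X Y : 'B(H)) : 'B(H) :=
  bounded_op_comp s' (bounded_op_comp (diag2 X Y) s).

Definition operator_nc (Sigma : set ('I_d -> 'B(H))) (f : Sigma -> 'B(H)) :=
  forall (X Y W : Sigma)
      (s : bounded_op H (copies 2 H)) (s' : bounded_op (copies 2 H) H),
    cancel s s' -> cancel s' s ->
    (forall i, val W i = conj_diag2 s s' (val X i) (val Y i)) ->
  f W = conj_diag2 s s' (f X) (f Y).

Definition Alg (Z : 'I_d -> 'B(H)) : set 'B(H) :=
  smallest [set A : set 'B(H) | [/\ A 1,
      forall c S T, A S -> A T -> A (c *: S + T) &
      forall S T, A S -> A T -> A (S * T)]]
    (range Z).

(* 'B(H) with the coarsest topology making all T |-> <T x, y> continuous. *)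
Definition wot : topologicalType :=
  initial_topology
    (fun T : 'B(H) => (fun u => inner (T u.1) u.2) : {ptws H * H -> R[i]^o}).

Definition wot_closure (A : set 'B(H)) : set 'B(H) := @closure wot A.

End OperatorNC.

Arguments nc_ball {R} H {d m n} delta.

(* Main.v *)
(* If a bounded L intertwines two points of the ball, L X = Y L, then
   L phi(X) = phi(Y) L (conjugate X (+) Y by a unitary H -> H (+) H and by its
   composite with a shear). To approximate phi(Z) by Alg(Z) on vectors
   x_1, ..., x_l, let N be the closed span in H^(l+1) of H (+) 0 and the vectors
   (0, w(Z) x_1, ..., w(Z) x_l), w a word. The summand H makes N infinite-dimensional, so
   there is an isometry V of H onto N; since N is invariant under the ampliation of Z, the
   compression X = V^-1 Z V is again in the ball, and each coordinate V_k of V intertwines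
   X and Z. Hence V_k phi(X) = phi(Z) V_k for all k, so the ampliation of phi(Z) leaves N
   invariant: phi(Z) is in the closure of Alg(Z) even for the strong operator topology. *)

Require Import Defs.
From HB Require Import structures.
From mathcomp Require Import all_boot all_order all_algebra.
From mathcomp Require Import sesquilinear complex.
From mathcomp Require Import all_classical all_reals all_analysis.

Set Implicit Arguments.
Unset Strict Implicit.
Unset Printing Implicit Defensive.

Import Order.TTheory GRing.Theory Num.Theory numFieldNormedType.Exports.

Local Open Scope classical_set_scope.
Local Open Scope ring_scope.

(** * Inner product identities and the Cauchy-Schwarz inequality *)

Section InnerProduct.
Context {R : realType} {H : hilbertType R}.
Implicit Types (x y z : H) (a : R[i]).

Lemma innerC x y : inner y x = (inner x y)^*.
Proof. by rewrite (hermC inner) expr0 mul1r. Qed.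

Lemma innerDl x y z : inner (x + y) z = inner x z + inner y z.
Proof. exact: linearDl. Qed.

Lemma innerDr x y z : inner z (x + y) = inner z x + inner z y.
Proof. exact: raddfD. Qed.

Lemma innerZl a x y : inner (a *: x) y = a * inner x y.
Proof. exact: linearZl_LR. Qed.

Lemma innerZr a x y : inner x (a *: y) = a^* * inner x y.
Proof. exact: linearZr_LR. Qed.

Lemma innerBl x y z : inner (x - y) z = inner x z - inner y z.
Proof. exact: linearBl. Qed.

Lemma inner0l x : inner 0 x = 0.
Proof. exact: linear0l. Qed.

Lemma inner_suml (I : Type) (r : seq I) (P : pred I) (F : I -> H) x :
  inner (\sum_(i <- r | P i) F i) x = \sum_(i <- r | P i) inner (F i) x.
Proof. exact: linear_sumlz. Qed.

Lemma pythagoras x y : inner x y = 0 -> `|x + y| ^+ 2 = `|x| ^+ 2 + `|y| ^+ 2.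
Proof.
move=> xy0; rewrite !normr_inner innerDl !innerDr xy0 (innerC x y) xy0 conjC0.
by rewrite addr0 add0r.
Qed.

Lemma CauchySchwarz_inner x y : `|inner x y| <= `|x| * `|y|.
Proof.
have [->|y0] := eqVneq y 0; first by rewrite innerC inner0l conjC0 !normr0 mulr0.
have ny0 : `|y| != 0 by rewrite normr_eq0.
(* [a *: y] is the orthogonal projection of [x] on the line of [y], so by Pythagoras it is no longer
   than [x]. *)
pose a := inner x y / inner y y.
have o : inner (x - a *: y) (a *: y) = 0.
  rewrite innerZr innerBl innerZl /a divfK ?subrr ?mulr0 //.
  by rewrite -normr_inner sqrf_eq0.
have := pythagoras o; rewrite subrK => e.
have : `|a *: y| ^+ 2 <= `|x| ^+ 2 by rewrite e lerDr exprn_ge0.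
rewrite ler_pXn2r ?nnegrE // normrZ /a normrM normfV -normr_inner normrX normr_id.
by rewrite expr2 invfM mulrA divfK // ler_pdivrMr // normr_gt0.
Qed.

End InnerProduct.

(** * The Hilbert space structure of a finite direct sum *)

Section CopiesHilbert.
Context {R : realType} (n : nat) (H : hilbertType R).

Lemma copies_norm2 (x : copies n H) : `|x| ^+ 2 = \sum_i `|x i| ^+ 2.
Proof. by rewrite copies_normE sqrtCK. Qed.

Lemma copies_complete (F : set_system (copies n H)) :
  ProperFilter F -> cauchy F -> cvg F.
Proof.
move=> FF /cauchy_ballP Fc.
have Fi (i : 'I_n) : cvg ((fun x : copies n H => x i) @ F).
  apply/cauchy_cvgP/cauchy_ballP => e e0.
  rewrite near_map2; apply: filterS (Fc e e0) => -[x y].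
  rewrite -!ball_normE /=; apply: le_lt_trans.
  exact: (copies_coord_le (x - y) i).
pose l : copies n H := fun i => lim ((fun x : copies n H => x i) @ F).
suff Fl : F --> l by exact: (cvgP l Fl).
apply/cvgrPdist_lt => e e0.
(* Dividing by [n.+1] covers [n = 0] and keeps the sum of [n] such bounds strictly below [e]. *)
have e1 : 0 < e / n.+1%:R by rewrite divr_gt0 // ltr0n.
have : \forall x \near F, forall i : 'I_n, `|l i - x i| < e / n.+1%:R.
  apply: filter_forall => i.
  by have /cvgrPdist_lt/(_ _ e1) := Fi i.
apply: filterS => x xl; apply: le_lt_trans (copies_norm_le _) _.
apply: (@le_lt_trans _ _ (\sum_(i < n) e / n.+1%:R)).
  by apply: ler_sum => i _; rewrite ltW // xl.
rewrite sumr_const card_ord -[X in X < _]mulr_natr mulrAC ltr_pdivrMr ?ltr0n //.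
by rewrite ltr_pM2l // ltr_nat.
Qed.

HB.instance Definition _ := Uniform_isComplete.Build (copies n H) copies_complete.

Definition copies_inner (x y : copies n H) : R[i] := \sum_i inner (x i) (y i).

Lemma copies_inner_bilinear :
  bilinear_for (GRing.Scale.Law.clone _ _ *%R _)
    (GRing.Scale.Law.clone _ _ (Num.conj \; *%R) _) copies_inner.
Proof.
split=> [y a x x'|x a y y'] /=; rewrite /copies_inner mulr_sumr -big_split /=.
  by apply: eq_bigr => i _; rewrite innerDl innerZl.
by apply: eq_bigr => i _; rewrite innerDr innerZr.
Qed.

HB.instance Definition _ := bilinear_isBilinear.Build R[i]
  (copies n H) (copies n H) R[i] _ _ copies_inner copies_inner_bilinear.

Lemma copies_innerC x y : copies_inner x y = (-1) ^+ false * (copies_inner y x)^*.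
Proof.
rewrite expr0 mul1r /copies_inner rmorph_sum.
by apply: eq_bigr => i _; exact: innerC.
Qed.

HB.instance Definition _ := isHermitianSesquilinear.Build R[i] (copies n H)
  false Num.conj copies_inner copies_innerC.

Lemma copies_normr_inner (x : copies n H) : `|x| ^+ 2 = copies_inner x x.
Proof. by rewrite copies_norm2; apply: eq_bigr => i _; rewrite normr_inner. Qed.

Lemma copies_inner_gt0 x : x != 0 -> 0 < copies_inner x x.
Proof. by move=> x0; rewrite -copies_normr_inner exprn_gt0 // normr_gt0. Qed.

HB.instance Definition _ := isDotProduct.Build R[i] (copies n H)
  copies_inner copies_inner_gt0.

HB.instance Definition _ := CompleteNormedModule_isHilbert.Build R (copies n H)
  copies_normr_inner.

End CopiesHilbert.

(** * Closed linear spans *)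

Section ClosedSpan.
Context {K : numFieldType} {V : normedModType K}.

Definition submod (A : set V) := A 0 /\ forall a x y, A x -> A y -> A (a *: x + y).

(** Taken as a least closed subspace, not as a closure of linear combinations: a property of the
    generators passes to the span as soon as it defines a closed subspace. *)
Definition closed_span : set V -> set V := smallest [set A | closed A /\ submod A].

Lemma sub_closed_span D : D `<=` closed_span D.
Proof. exact: sub_smallest. Qed.

Lemma closed_span_min D A : closed A -> submod A -> D `<=` A -> closed_span D `<=` A.
Proof. by move=> cA sA DA; apply: smallest_sub. Qed.

Lemma closed_closed_span D : closed (closed_span D).
Proof. by apply: closed_bigI => A [[]]. Qed.

Lemma submod_closed_span D : submod (closed_span D).
Proof.
split=> [A [[_ []]] //|a x y Dx Dy A DA].
by have [[_ [_ sA]] _] := DA; apply: sA; [exact: Dx|exact: Dy].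
Qed.

Lemma submod_sum (A : set V) (I : Type) (r : seq I) (P : pred I) (F : I -> V) :
  submod A -> (forall i, A (F i)) -> A (\sum_(i <- r | P i) F i).
Proof.
move=> [A0 sA] AF; elim/big_ind: _ => // x y Ax Ay.
by rewrite -[x]scale1r; exact: sA.
Qed.

Lemma submodZ (A : set V) a x : submod A -> A x -> A (a *: x).
Proof. by move=> [A0 sA] Ax; rewrite -[_ *: _]addr0; exact: sA. Qed.

Lemma submodB (A : set V) x y : submod A -> A x -> A y -> A (x - y).
Proof. by move=> [_ sA] Ax Ay; rewrite addrC -scaleN1r; exact: sA. Qed.

Lemma closed_span_eq D E :
  D `<=` closed_span E -> E `<=` closed_span D -> closed_span D = closed_span E.
Proof.
move=> DE ED; apply/seteqP; split; apply: closed_span_min => //;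
  [exact: closed_closed_span|exact: submod_closed_span
  |exact: closed_closed_span|exact: submod_closed_span].
Qed.

End ClosedSpan.

(** * Bounded operators and closed spans *)

Lemma bounded_linear_op (K : numFieldType) (U V : normedModType K) (f : U -> V) (M : K) :
  0 <= M -> linear f -> (forall x, `|f x| <= M * `|x|) -> f \in @bounded_op_pred K U V.
Proof.
move=> M0 lf fM; apply/bounded_opP; split=> //.
pose g : {linear U -> V} := HB.pack f (GRing.isLinear.Build _ _ _ _ f lf).
apply: (@bounded_linear_continuous _ _ _ g); apply/linear_boundedP.
exists M; split=> [|r /ltW r1 x]; first exact: ger0_real.
by rewrite (le_trans (fM x)) // ler_wpM2r.
Qed.

Lemma bounded_op_compE (K : numFieldType) (U V W : normedModType K)
    (S : bounded_op V W) (T : bounded_op U V) x : bounded_op_comp S T x = S (T x).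
Proof. by []. Qed.

Section BoundedOpClosed.
Context {K : numFieldType} {U V : normedModType K}.
Implicit Types T : bounded_op U V.

Lemma closed_preimage_op T (A : set V) : closed A -> closed (T @^-1` A).
Proof. by move=> cA; apply: preimage_closed => // x _; exact: bounded_op_continuous. Qed.

Lemma submod_preimage_op T (A : set V) : submod A -> submod (T @^-1` A).
Proof.
move=> [A0 sA]; split=> [|a x y Ax Ay] /=; first by rewrite raddf0.
by rewrite linearP; exact: sA.
Qed.

Lemma closed_span_op T D (E : set V) x :
  (forall y, D y -> closed_span E (T y)) -> closed_span D x -> closed_span E (T x).
Proof.
move=> DE; apply: (closed_span_min (A := T @^-1` closed_span E)) => //.
  by apply: closed_preimage_op; exact: closed_closed_span.
by apply: submod_preimage_op; exact: submod_closed_span.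
Qed.

Lemma closed_eq_op (S T : bounded_op U V) : closed [set x | S x = T x].
Proof.
have -> : [set x | S x = T x] = (S - T : bounded_op U V) @^-1` [set 0].
  apply/seteqP; split=> x /=.
    by move=> e; rewrite -[LHS]/(S x - T x) e subrr.
  by move=> /eqP; rewrite -[X in X == 0]/(S x - T x) subr_eq0 => /eqP.
apply: closed_preimage_op; apply: accessible_closed_set1.
exact: hausdorff_accessible (@norm_hausdorff _ _).
Qed.

Lemma submod_eq_op (S T : bounded_op U V) : submod [set x | S x = T x].
Proof.
split=> [|a x y /= ex ey]; first by rewrite /= !raddf0.
by rewrite !linearP /= ex ey.
Qed.

Lemma eq_op_closed_span (S T : bounded_op U V) D x :
  (forall y, D y -> S y = T y) -> closed_span D x -> S x = T x.
Proof.
move=> DST; apply: (closed_span_min (A := [set x | S x = T x])) => //.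
  exact: closed_eq_op.
exact: submod_eq_op.
Qed.

End BoundedOpClosed.

(** * Orthonormal sequences: Bessel's inequality and convergence of series *)

Section Orthonormal.
Context {R : realType} {E : hilbertType R}.
Implicit Types (f : nat -> E) (x y : E) (c : nat -> R[i]) (r : seq nat).

Definition orthonormal_seq f := forall i j, inner (f i) (f j) = (i == j)%:R.

Lemma orthonormal_norm f : orthonormal_seq f -> forall i, `|f i| = 1.
Proof.
move=> fo i; apply/eqP; rewrite -(@eqrXn2 _ 2) // expr1n.
by rewrite normr_inner fo eqxx.
Qed.

Lemma orthonormal_coef f c r i : orthonormal_seq f -> uniq r ->
  inner (\sum_(j <- r) c j *: f j) (f i) = if i \in r then c i else 0.
Proof.
move=> fo ru; rewrite inner_suml.
under eq_bigr do rewrite innerZl fo -mulr_natr mulr_natr.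
case: ifPn => ir.
  rewrite (bigD1_seq i) //= eqxx mulr1 big1 ?addr0 // => j /negbTE ->.
  by rewrite mulr0.
rewrite big_seq big1 // => j jr; case: eqP => [ji|]; last by rewrite mulr0.
by rewrite -ji jr in ir.
Qed.

Lemma orthonormal_norm_sum f c r : orthonormal_seq f -> uniq r ->
  `|\sum_(j <- r) c j *: f j| ^+ 2 = \sum_(j <- r) `|c j| ^+ 2.
Proof.
move=> fo; elim: r => [|i r IH] /=; first by rewrite !big_nil normr0 expr0n.
move=> /andP[ir ru]; rewrite !big_cons addrC pythagoras.
  by rewrite IH // normrZ orthonormal_norm // mulr1 addrC.
by rewrite innerZr orthonormal_coef // (negbTE ir) mulr0.
Qed.

(** The partial Fourier sum [P] is orthogonal to [x - P], so Pythagoras bounds its norm by that of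
    [x]. *)
Lemma bessel f x r : orthonormal_seq f -> uniq r ->
  \sum_(j <- r) `|inner x (f j)| ^+ 2 <= `|x| ^+ 2.
Proof.
move=> fo ru; set P := \sum_(j <- r) inner x (f j) *: f j.
have o : inner (x - P) P = 0.
  rewrite innerC inner_suml big_seq big1 ?conjC0 // => j jr.
  rewrite innerZl [inner (f j) _]innerC innerBl /P.
  by rewrite (orthonormal_coef (fun j => inner x (f j))) // jr subrr conjC0 mulr0.
have := pythagoras o; rewrite subrK => ->.
by rewrite -(orthonormal_norm_sum (fun j => inner x (f j)) fo ru) lerDr exprn_ge0.
Qed.

(** Riesz-Fischer: by Pythagoras the squared norm of a block of the series is the matching block of
    the series of [|c j|^2], which is bounded with nonnegative terms, hence Cauchy. *)
Lemma orthonormal_series_cvg f c (M : R[i]) : orthonormal_seq f ->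
  (forall k, \sum_(0 <= j < k) `|c j| ^+ 2 <= M) ->
  cvgn (series (fun j => c j *: f j)).
Proof.
move=> fo cM; apply/cauchy_cvgP/cauchy_seriesP => e e0.
(* Monotone convergence takes place in [R], so the squared moduli, of type [R[i]], are replaced by
   their real parts. *)
pose b j : R := complex.Re (`|c j| ^+ 2).
have bE j : `|c j| ^+ 2 = (b j)%:C%C.
  by rewrite RRe_real // ger0_real // exprn_ge0.
have b0 j : 0 <= b j by rewrite -lecR -bE exprn_ge0.
have M0 : 0 <= M by have := cM 0; rewrite big_geq.
have bcv : cvgn (series b).
  apply: nondecreasing_is_cvgn; first exact: nondecreasing_series.
  exists (complex.Re M) => _ [k _ <-]; rewrite -lecR RRe_real ?ger0_real //.
  rewrite /series /= rmorph_sum /=; apply: le_trans (cM k).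
  by under eq_bigr do rewrite -bE.
have eE : e = (complex.Re e)%:C%C by rewrite RRe_real // gtr0_real.
have e20 : 0 < complex.Re e ^+ 2 by rewrite exprn_gt0 // -ltcR -eE.
have /cauchy_cvgP/cauchy_seriesP/(_ _ e20) := bcv.
apply: filterS => -[m k] /=.
rewrite ger0_norm ?sumr_ge0 // -ltcR rmorph_sum rmorphXn /= -eE => lt.
rewrite -(@ltr_pXn2r _ 2) ?nnegrE ?(ltW e0) //.
rewrite orthonormal_norm_sum ?iota_uniq //.
by under eq_bigr do rewrite bE.
Qed.

End Orthonormal.

(** * Partial isometries between spans of orthonormal sequences *)

Section Transfer.
Context {R : realType} {E F : hilbertType R}.
Variables (e : nat -> E) (f : nat -> F).
Hypotheses (eo : orthonormal_seq e) (fo : orthonormal_seq f).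

Let S (x : E) := series (fun j => inner x (e j) *: f j).

(** The partial isometry that carries [e j] to [f j] and vanishes on the orthogonal complement of
    the [e j]. *)
Definition transfer_fun (x : E) : F := limn (S x).

Let transfer_cvg x : S x @ \oo --> transfer_fun x.
Proof.
apply: (orthonormal_series_cvg (M := `|x| ^+ 2)) => // k.
by apply: bessel; rewrite // iota_uniq.
Qed.

Let transfer_linear : linear transfer_fun.
Proof.
move=> a x y; apply: cvg_lim; first exact: norm_hausdorff.
have -> : S (a *: x + y) = a *: S x + S y.
  apply/funext => k; rewrite -[RHS]/(a *: S x k + S y k) /S /series /=.
  rewrite scaler_sumr -big_split /=.
  by apply: eq_bigr => j _; rewrite innerDl innerZl scalerDl scalerA.
apply: (cvgD (f := a *: S x)); last exact: transfer_cvg.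
by apply: (cvgZl_tmp (f := S x)); exact: transfer_cvg.
Qed.

Let transfer_contractive x : `|transfer_fun x| <= `|x|.
Proof.
apply/ler_addgt0Pr => d d0.
have /cvgrPdist_lt/(_ _ d0) [k _ /(_ _ (leqnn k)) kd] := transfer_cvg (x := x).
rewrite -(subrK (S x k) (transfer_fun x)) (le_trans (ler_normD _ _)) //.
rewrite addrC lerD ?(ltW kd) // -(@ler_pXn2r _ 2) ?nnegrE //.
by rewrite orthonormal_norm_sum ?bessel ?iota_uniq.
Qed.

Fact transfer_subproof : transfer_fun \in @bounded_op_pred R[i] E F.
Proof. by apply: contractive_bounded_op. Qed.

Definition transfer : bounded_op E F := BoundedOp transfer_subproof.

Lemma transfer_le x : `|transfer x| <= `|x|.
Proof. exact: transfer_contractive. Qed.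

Lemma transfer_basis i : transfer (e i) = f i.
Proof.
apply: cvg_lim; first exact: norm_hausdorff.
apply: (@cvg_near_cst _ _ (f i)); exists i.+1 => // k /= ik.
rewrite /S /series /= (bigD1_seq i) ?iota_uniq ?mem_index_iota //=.
rewrite eo eqxx scale1r big1 ?addr0 // => j ji.
by rewrite eo eq_sym (negbTE ji) scale0r.
Qed.

Lemma transfer_closed_span x : closed_span (range f) (transfer x).
Proof.
have sf := submod_closed_span (range f).
rewrite [transfer x]/(transfer_fun x).
apply: (@closed_cvg _ _ \oo _ (S x) (closed_span (range f)) _ _ _ (@transfer_cvg x)).
  exact: closed_closed_span.
apply: nearW => k; rewrite /S /series /=; apply: (submod_sum _ _ sf) => j; apply: (submodZ _ sf).
by apply: sub_closed_span; exists j.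
Qed.

End Transfer.

(** Both sides are bounded operators in [x] that agree at each [e i], hence on the closed span. *)
Lemma transferK (R : realType) (E F : hilbertType R) (e : nat -> E) (f : nat -> F)
    (eo : orthonormal_seq e) (fo : orthonormal_seq f) x :
  closed_span (range e) x -> transfer fo eo (transfer eo fo x) = x.
Proof.
pose T := bounded_op_comp (transfer fo eo) (transfer eo fo).
apply: (@eq_op_closed_span _ _ _ T (bounded_op_id E)).
by move=> _ [i _ <-]; rewrite bounded_op_compE !transfer_basis.
Qed.

(** * Gram-Schmidt orthonormalisation *)

Section GramSchmidt.
Context {R : realType} {E : hilbertType R}.
Implicit Types (s : seq E) (x y : E).

(** For orthonormal [s] this is the orthogonal projection on its span; for other lists it is only an
    operator of finite rank. *)
Definition proj s y : E := \sum_(e <- s) inner y e *: e.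

Lemma proj_rcons s e y : proj (rcons s e) y = proj s y + inner y e *: e.
Proof. by rewrite /proj -cats1 big_cat big_seq1. Qed.

Fact proj_subproof s : proj s \in @bounded_op_pred R[i] E E.
Proof.
apply: (@bounded_linear_op _ _ _ _ (\sum_(e <- s) `|e| ^+ 2)).
- by apply: sumr_ge0 => e _; rewrite exprn_ge0.
- move=> a x y; rewrite /proj scaler_sumr -big_split /=.
  by apply: eq_bigr => e _; rewrite innerDl innerZl scalerDl scalerA.
- move=> x; rewrite mulr_suml (le_trans (ler_norm_sum _ _ _)) //.
  apply: ler_sum => e _; rewrite normrZ expr2 mulrC -mulrA ler_wpM2l //.
  by rewrite mulrC CauchySchwarz_inner.
Qed.

Definition proj_op s : 'B(E) := BoundedOp (proj_subproof s).

Variable g : nat -> E.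
Hypothesis g_infinite : forall s, exists j, proj s (g j) != g j.

(** Asking [g_infinite] of every list, orthonormal or not, makes this a total function, so the
    recursion can be set up before orthonormality is proved. *)
Definition gs_index s := ex_minn (g_infinite s).
Definition gs_residual s := g (gs_index s) - proj s (g (gs_index s)).
Definition gs_next s := `|gs_residual s|^-1 *: gs_residual s.
Definition gs_list k := iter k (fun s => rcons s (gs_next s)) [::].
Definition gs k := gs_next (gs_list k).

Lemma gs_residual_neq0 s : gs_residual s != 0.
Proof.
by rewrite /gs_residual /gs_index; case: ex_minnP => j; rewrite subr_eq0 eq_sym.
Qed.

Lemma proj_gs_list k y : proj (gs_list k) y = \sum_(0 <= j < k) inner y (gs j) *: gs j.
Proof.
elim: k => [|k IH]; first by rewrite /proj big_nil big_geq.
by rewrite big_nat_recr //= proj_rcons IH.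
Qed.

Lemma norm_gs k : `|gs k| = 1.
Proof. by rewrite /gs /gs_next normrZ normfV normr_id mulVf // normr_eq0 gs_residual_neq0. Qed.

(** The residual has lost its components along the earlier vectors, which are orthonormal by
    induction. *)
Lemma gs_orthogonal k i : (i < k)%N -> inner (gs k) (gs i) = 0.
Proof.
elim/ltn_ind: k i => k IH i ik.
rewrite {1}/gs /gs_next innerZl innerBl proj_gs_list inner_suml.
rewrite (bigD1_seq i) ?iota_uniq ?mem_index_iota //= innerZl.
rewrite -normr_inner norm_gs expr1n mulr1 big_seq_cond big1 ?addr0 ?subrr ?mulr0 //.
move=> j /andP[]; rewrite mem_index_iota /= => jk ji; rewrite innerZl.
(* The induction hypothesis has the later vector first, so it is used at [j] or, after conjugation,
   at [i]. *)
have [ij|ij] := ltnP i j; first by rewrite IH ?mulr0.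
have {}ij : (j < i)%N by rewrite ltn_neqAle ji.
by rewrite [inner (gs j) _]innerC IH // conjC0 mulr0.
Qed.

Lemma gs_orthonormal : orthonormal_seq gs.
Proof.
move=> i j; have [->|] := eqVneq i j; first by rewrite -normr_inner norm_gs expr1n.
by rewrite neq_ltn => /orP[] ij; [rewrite innerC|]; rewrite gs_orthogonal ?conjC0.
Qed.

(** A vector in the span of the first [k] vectors is orthogonal to [gs k], so the added term is
    zero. *)
Lemma proj_gs_succ k y : proj (gs_list k) y = y -> proj (gs_list k.+1) y = y.
Proof.
move=> yk; rewrite proj_rcons -/(gs k) yk -yk proj_gs_list.
rewrite (orthonormal_coef (fun j => inner y (gs j))) ?iota_uniq //; last exact: gs_orthonormal.
by rewrite mem_index_iota ltnn andbF scale0r addr0.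
Qed.

Lemma proj_gs_index k (s := gs_list k) :
  proj (gs_list k.+1) (g (gs_index s)) = g (gs_index s).
Proof.
set y := g _; have yE : y = proj s y + `|gs_residual s| *: gs k.
  rewrite /gs /gs_next scalerA mulfV ?normr_eq0 ?gs_residual_neq0 // scale1r.
  by rewrite addrC subrK.
have o i : (i < k)%N -> inner (gs k) (gs i) = 0 by exact: gs_orthogonal.
have -> : proj (gs_list k.+1) y = proj s y + inner y (gs k) *: gs k.
  by rewrite proj_rcons.
rewrite {2}yE innerDl innerZl -normr_inner norm_gs expr1n mulr1.
rewrite proj_gs_list.
rewrite (orthonormal_coef (fun j => inner y (gs j))) ?iota_uniq //; last exact: gs_orthonormal.
by rewrite mem_index_iota ltnn andbF add0r -proj_gs_list -yE.
Qed.

(** Each step treats the least index not yet fixed, so [k] steps fix at least the indices below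
    [k]. *)
Lemma proj_gs k j : (j < k)%N -> proj (gs_list k) (g j) = g j.
Proof.
elim: k j => // k IH j; rewrite ltnS leq_eqVlt => /predU1P[->|/IH]; last first.
  exact: proj_gs_succ.
have := proj_gs_index k; rewrite /gs_index; case: ex_minnP => i ik imin.
(* If the index [i] treated at step [k] is not [k], then [g k] was already fixed: otherwise
   minimality gives [i < k], and such an [i] is fixed by induction. *)
have [->//|ki] := eqVneq i k.
move=> _; apply: proj_gs_succ; apply/eqP; apply: contraT => kn.
have := imin _ kn; rewrite leq_eqVlt (negbTE ki) /= => /IH iE.
by rewrite iE eqxx in ik.
Qed.

Lemma gs_closed_span k : closed_span (range g) (gs k).
Proof.
have sg := submod_closed_span (range g).
elim/ltn_ind: k => k IH; apply: (submodZ _ sg); apply: (submodB sg).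
  by apply: sub_closed_span; exists (gs_index (gs_list k)).
rewrite proj_gs_list big_seq; elim/big_ind: _ => [|x y xg yg|j].
- by case: sg.
- by rewrite -[x]scale1r; apply: sg.2.
- by rewrite mem_index_iota => /andP[_ jk]; apply: (submodZ _ sg); exact: IH.
Qed.

Lemma closed_span_gs : closed_span (range gs) = closed_span (range g).
Proof.
apply: closed_span_eq => _ [k _ <-]; first exact: gs_closed_span.
have sg := submod_closed_span (range gs).
rewrite -(proj_gs (ltnSn k)) proj_gs_list; apply: (submod_sum _ _ sg) => j.
by apply: (submodZ _ sg); apply: sub_closed_span; exists j.
Qed.

End GramSchmidt.

(** The map [L] forces the span to be infinite-dimensional: a finite list whose [proj] fixed every
    generator would fix the whole span, and the images of its members under [L] would span [H]. *)
Lemma orthonormal_basis_exists (R : realType) (H E : hilbertType R) (T : countType)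
    (g : T -> E) (L : bounded_op E H) : infinite_dimensional H ->
    (forall h, exists2 y, closed_span (range g) y & L y = h) ->
  exists2 f : nat -> E, orthonormal_seq f & closed_span (range f) = closed_span (range g).
Proof.
(* Numbers that encode no element of [T] go to 0, which leaves the closed span unchanged. *)
move=> Hinf Lsurj; pose g' (j : nat) := oapp g 0 (unpickle j).
have g'E : closed_span (range g') = closed_span (range g).
  apply: closed_span_eq => _ [j _ <-]; last first.
    by apply: sub_closed_span; exists (pickle j); rewrite // /g' pickleK.
  rewrite /g'; case: unpickle => [t|] /=; last exact: (submod_closed_span _).1.
  by apply: sub_closed_span; exists t.
rewrite -g'E in Lsurj *.
suff ginf s : exists j, proj s (g' j) != g' j.
  by exists (gs ginf); [exact: gs_orthonormal|exact: closed_span_gs].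
apply: contrapT => nex; apply: Hinf.
have gs j : proj s (g' j) = g' j by apply: contrapT => /eqP ne; apply: nex; exists j.
exists (size s), (fun i => L (tnth (in_tuple s) i)) => h.
have [y yg <-] := Lsurj h; exists (fun i => inner y (tnth (in_tuple s) i)).
have py : proj s y = y.
  apply: (@eq_op_closed_span _ _ _ (proj_op s) (bounded_op_id E) _ _ _ yg).
  by move=> _ [j _ <-]; exact: gs.
rewrite -{1}py /proj raddf_sum big_tnth.
by apply: eq_bigr => i _; exact: linearZ_LR.
Qed.

(** * The operator norm as the least bound *)

Section OperatorNorm.
Context {R : realType} {U V : normedModType R[i]}.
Implicit Types (T : bounded_op U V) (c : R).

Lemma Re_normK (W : normedModType R[i]) (x : W) : (complex.Re `|x|)%:C%C = `|x|.
Proof. by rewrite RRe_real // normr_real. Qed.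

Lemma opnorm_le T c : (forall x, `|T x| <= c%:C%C * `|x|) -> 0 <= c -> opnorm T <= c.
Proof.
move=> Tc c0; apply: ge_sup; first by exists (complex.Re `|T 0|), 0 => //=; rewrite normr0.
move=> _ [x /= x1 <-]; rewrite -lecR Re_normK (le_trans (Tc x)) //.
by rewrite -[leRHS]mulr1 ler_wpM2l // lecR.
Qed.

Lemma le_opnorm T x : `|T x| <= (opnorm T)%:C%C * `|x|.
Proof.
(* Continuity bounds the set of norms, so that [sup] is a genuine supremum and not a default
   value. *)
have [M M0 TM] : exists2 M : R[i], 0 < M & forall y, `|T y| <= M * `|y|.
  have Tb := continuous_linear_bounded 0 (@bounded_op_continuous _ _ _ T 0).
  by have /linear_boundedP/pinfty_ex_gt0[M M0 TM] := Tb; exists M.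
have sT : has_sup [set complex.Re `|T y| | y in [set y : U | `|y| <= 1]].
  split; first by exists (complex.Re `|T 0|), 0 => //=; rewrite normr0.
  exists (complex.Re M) => _ [y /= y1 <-].
  rewrite -lecR Re_normK RRe_real ?gtr0_real // (le_trans (TM y)) //.
  by rewrite -[leRHS]mulr1 ler_wpM2l // ltW.
have [->|x0] := eqVneq x 0; first by rewrite raddf0 !normr0 mulr0.
have nx : 0 < `|x| by rewrite normr_gt0.
rewrite -ler_pdivrMr // -[X in X / _]Re_normK -(Re_normK x) -fmorphV -rmorphM lecR.
apply: (sup_upper_bound sT); exists (`|x|^-1 *: x) => /=.
  by rewrite normrZ normfV normr_id mulVf // gt_eqF.
apply/(@complexI R); rewrite rmorphM fmorphV /= !Re_normK.
by rewrite linearZ_LR /= normrZ normfV normr_id mulrC.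
Qed.

End OperatorNorm.

(** * Intertwiners, polynomial evaluation and the ball *)

Section NCEval.
Context {K : numFieldType} {U V : normedModType K} (d : nat).
Variables (L : bounded_op U V) (X : 'I_d -> 'B(U)) (Y : 'I_d -> 'B(V)).
Hypothesis LXY : forall i u, L (X i u) = Y i (L u).

Lemma nc_eval_intertwine (p : nc_poly K d) u : L (nc_eval X p u) = nc_eval Y p (L u).
Proof.
have word (w : seq 'I_d) v : L ((\prod_(i <- w) X i) v) = (\prod_(i <- w) Y i) (L v).
  elim: w v => [|i w IH] v; first by rewrite !big_nil.
  rewrite !big_cons -[LHS]/(L (X i ((\prod_(j <- w) X j) v))) LXY IH.
  by [].
rewrite /nc_eval; elim/big_rec2: _ => [|w S T _ IH]; first by rewrite raddf0.
rewrite -[LHS]/(L (_ *: (\prod_(i <- _) X i) u + T u)).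
by rewrite linearP /= IH word.
Qed.

End NCEval.

Section Ball.
Context {R : realType} {H : hilbertType R} {d m n : nat}.
Variable delta : 'M[nc_poly R[i] d]_(m, n).

Lemma coord_op_intertwine (N : nat) (V : bounded_op H (copies N H)) (X : 'I_d -> 'B(H))
    (Y : 'I_N -> 'I_d -> 'B(H)) (p : nc_poly R[i] d) :
    (forall i h k, V (X i h) k = Y k i (V h k)) ->
  forall h k, V (nc_eval X p h) k = nc_eval (Y k) p (V h k).
Proof.
move=> VXY h k.
pose Vk := bounded_op_comp (BoundedOp (coord_bounded_op _ k)) V.
exact: (@nc_eval_intertwine _ _ _ _ Vk _ (Y k) (fun i u => VXY i u k)).
Qed.

(** Applied entrywise, [V] is isometric and intertwines [nc_eval_mx delta X] with the direct sum of
    the [nc_eval_mx delta (Y k)], whose norm is at most the largest of theirs; as there are finitely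
    many [k], this stays below 1. *)
Lemma nc_ball_restrict (N : nat) (V : bounded_op H (copies N H)) (X : 'I_d -> 'B(H))
    (Y : 'I_N -> 'I_d -> 'B(H)) : (forall h, `|V h| = `|h|) ->
    (forall i h k, V (X i h) k = Y k i (V h k)) ->
    (forall k, nc_ball H delta (Y k)) -> nc_ball H delta X.
Proof.
move=> Viso VXY Yball.
pose c : R := \big[Num.max/0]_(k < N) opnorm (nc_eval_mx delta (Y k)).
have c1 : c < 1 by apply/bigmax_ltP; split=> // k _; exact: Yball.
have c0 : 0 <= c by exact: bigmax_ge_id.
apply: le_lt_trans c1; apply: opnorm_le => // x.
rewrite -(@ler_pXn2r _ 2) ?nnegrE ?mulr_ge0 ?lecR // exprMn !copies_norm2.
have sumE p (y : copies p H) :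
    \sum_i `|y i| ^+ 2 = \sum_(k < N) \sum_i `|V (y i) k| ^+ 2.
  by under eq_bigr do rewrite -Viso copies_norm2; rewrite exchange_big.
rewrite !sumE mulr_sumr.
apply: ler_sum => k _; pose xk : copies n H := fun j => V (x j) k.
have -> : \sum_(j < n) `|V (x j) k| ^+ 2 = `|xk| ^+ 2 by rewrite copies_norm2.
have -> : \sum_(i < m) `|V (nc_eval_mx delta X x i) k| ^+ 2 =
    `|nc_eval_mx delta (Y k) xk| ^+ 2.
  rewrite copies_norm2; apply: eq_bigr => i _; congr (`|_| ^+ 2).
  rewrite /= raddf_sum fct_sumE; apply: eq_bigr => j _.
  by rewrite !mxE; exact: coord_op_intertwine.
rewrite -exprMn ler_pXn2r ?nnegrE ?mulr_ge0 ?lecR //.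
apply: le_trans (le_opnorm _ _) _; rewrite ler_wpM2r // lecR.
exact: le_bigmax.
Qed.

End Ball.

(** * Separability and isometries onto closed spans *)

Lemma separable_total_seq (R : realType) (H : hilbertType R) : separable H ->
  exists q : nat -> H, forall x, closed_span (range q) x.
Proof.
(* [q] inverts the injection [r] of the dense set [A] into the naturals, with value 0 outside its
   image. *)
move=> [A [/countable_injP [r rI] dA]]; pose q j := xget 0 [set a | A a /\ r a = j].
exists q => x; have cq := @closed_closed_span _ _ (range q).
have Aq : A `<=` closed_span (range q).
  move=> a Aa; apply: sub_closed_span; exists (r a) => //; rewrite /q.
  case: xgetP => [b _ [Ab rb]|/(_ a)]; last by case.
  by apply: rI; rewrite ?inE.
(* The complement of the closed span is open, so if inhabited it would meet [A]. *)
apply: contrapT => nx; have [||y [ny /Aq]] // := dA (~` closed_span (range q)).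
  by exists x.
by rewrite openC.
Qed.

Section Isometry.
Context {R : realType} {H : hilbertType R}.
Hypothesis H_infinite : infinite_dimensional H.
Variable q : nat -> H.
Hypothesis q_total : forall x, closed_span (range q) x.

(** [V] matches an orthonormal basis of [H] with one of the closed span of [g], and [W] is its
    adjoint; [L] certifies that this span is infinite-dimensional. *)
Lemma isometry_onto (E : hilbertType R) (T : countType) (g : T -> E) (L : bounded_op E H) :
    (forall h, exists2 y, closed_span (range g) y & L y = h) ->
  exists (V : bounded_op H E) (W : bounded_op E H),
    [/\ cancel V W, forall h, `|V h| = `|h|, forall h, closed_span (range g) (V h) &
        forall y, closed_span (range g) y -> V (W y) = y].
Proof.
move=> Lsurj.
have [f fo fg] := orthonormal_basis_exists H_infinite Lsurj.
have [e eo eq] : exists2 e : nat -> H, orthonormal_seq e &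
    closed_span (range e) = closed_span (range q).
  by apply: (orthonormal_basis_exists (L := bounded_op_id H)) => // h; exists h.
have VK : cancel (transfer eo fo) (transfer fo eo).
  by move=> h; apply: transferK; rewrite eq.
exists (transfer eo fo), (transfer fo eo); split=> // [h|h|y yg].
(* Both transfers are contractions and [VK] recovers [h] from its image, so no norm is lost. *)
- apply/le_anti; rewrite transfer_le -{1}[h](VK h) transfer_le //.
- by rewrite -fg; exact: transfer_closed_span.
- by apply: transferK; rewrite fg.
Qed.

Definition copies_inj n (k : 'I_n) : bounded_op H (copies n H) := BoundedOp (inj_bounded_op H k).

Definition copies_proj n (k : 'I_n) : bounded_op (copies n H) H := BoundedOp (coord_bounded_op H k).

Lemma copies_injE n (k l : 'I_n) h : copies_inj k h l = if l == k then h else 0.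
Proof. by []. Qed.

Lemma copies_injK n (k : 'I_n) : cancel (copies_inj k) (copies_proj k).
Proof. by move=> h /=; rewrite eqxx. Qed.

Lemma copies_sum_inj n (x : copies n H) : x = \sum_k copies_inj k (x k).
Proof.
apply/funext => l; rewrite fct_sumE (bigD1 l) //= eqxx big1 ?addr0 // => k kl.
by rewrite eq_sym (negbTE kl).
Qed.

(** The copies of [q] in all slots generate the whole direct sum, and a slot projection maps it onto
    [H], so [isometry_onto] applies. *)
Lemma unitary_copies n : (0 < n)%N ->
  exists (u : bounded_op H (copies n H)) (u' : bounded_op (copies n H) H),
    [/\ cancel u u', cancel u' u & forall h, `|u h| = `|h|].
Proof.
move=> n0; pose g (t : 'I_n * nat) := copies_inj t.1 (q t.2).
have sg := submod_closed_span (range g).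
have g_inj k h : closed_span (range g) (copies_inj k h).
  apply: closed_span_op (q_total h) => _ [j _ <-].
  by apply: sub_closed_span; exists (k, j).
have [|u [u' [uK uiso _ u'K]]] := @isometry_onto (copies n H) _ g (copies_proj (Ordinal n0)).
  move=> h; exists (copies_inj (Ordinal n0) h); first exact: g_inj.
  exact: copies_injK.
exists u, u'; split=> // y; apply: u'K.
by rewrite [y]copies_sum_inj; exact: (submod_sum _ _ sg).
Qed.

End Isometry.

(** * Operator NC functions preserve intertwining relations *)

Section Intertwining.
Context {R : realType} {H : hilbertType R} {d m n : nat}.
Variable delta : 'M[nc_poly R[i] d]_(m, n).

Definition shear (L : 'B(H)) : 'B(copies 2 H) :=
  op_matrix (\matrix_(i < 2, j < 2) if i == j then 1 else if i == 0 then 0 else L).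

Lemma shearE L x : (shear L x 0 = x 0) * (shear L x 1 = L (x 0) + x 1).
Proof.
split; rewrite /= big_ord_recl big_ord1 !mxE /=.
  by rewrite [X in _ + X]/(0 : H) addr0.
by congr (_ + _); congr (x _); exact: val_inj.
Qed.

Lemma diag2E (X Y : 'B(H)) x : (diag2 X Y x 0 = X (x 0)) * (diag2 X Y x 1 = Y (x 1)).
Proof.
split; rewrite /= big_ord_recl big_ord1 !mxE /=.
  by rewrite [X in _ + X]/(0 : H) addr0.
rewrite [X in X + _]/(0 : H) add0r; congr (Y (x _)); exact: val_inj.
Qed.

Lemma copies2P (x y : copies 2 H) : x 0 = y 0 -> x 1 = y 1 -> x = y.
Proof.
move=> e0 e1; apply/funext => -[[|[|//]] i].
  by rewrite (_ : Ordinal i = 0) //; exact: val_inj.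
by rewrite (_ : Ordinal i = 1) //; exact: val_inj.
Qed.

Lemma shearK L : cancel (shear L) (shear (- L)).
Proof.
move=> x; apply: copies2P; rewrite !shearE //.
by rewrite [(- L) _]/(- L _) addKr.
Qed.

Lemma shearVK L : cancel (shear (- L)) (shear L).
Proof. by rewrite -{2}[L]opprK; exact: shearK. Qed.

(* With [s = (1 0; L 1)], the relation [L X = Y L] makes [s] commute with
   [X (+) Y]; compare the values of [phi] at the same point
   [u^-1 (X (+) Y) u] read through the similarities [u] and [s u]. *)
Lemma operator_nc_intertwine (phi : nc_ball H delta -> 'B(H))
    (u : bounded_op H (copies 2 H)) (u' : bounded_op (copies 2 H) H)
    (X Y : nc_ball H delta) (L : 'B(H)) :
    operator_nc phi -> cancel u u' -> cancel u' u -> (forall h, `|u h| = `|h|) ->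
    (forall i h, L (val X i h) = val Y i (L h)) ->
  forall h, L (phi X h) = phi Y (L h).
Proof.
move=> nc uK u'K uiso LXY h.
pose W i := conj_diag2 u u' (val X i) (val Y i).
(* The coordinates of the isometry [u] intertwine [W] with [X] and with [Y]. *)
have Wball : nc_ball H delta W.
  apply: (@nc_ball_restrict _ _ _ _ _ delta 2 u W
    (fun k => if k == 0 then val X else val Y)) => // [i x k|k].
    rewrite /W /conj_diag2 !bounded_op_compE u'K.
    have [->|k0] := eqVneq k 0; first by rewrite diag2E.
    suff -> : k = 1 by rewrite diag2E.
    by apply: val_inj; case: k k0 => -[|[|]].
  by case: ifP => _; exact: set_valP.
have W1 := @nc X Y (exist _ W (mem_set Wball)) u u' uK u'K (fun=> erefl).
pose s := bounded_op_comp (shear L) u.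
pose s' := bounded_op_comp u' (shear (- L)).
have sK : cancel s s' by move=> x; rewrite !bounded_op_compE shearK uK.
have s'K : cancel s' s by move=> x; rewrite !bounded_op_compE u'K shearVK.
have W2 := @nc X Y (exist _ W (mem_set Wball)) s s' sK s'K.
have {}W2 := W2 _.
(* At [(h, 0)] the second coordinates of the two sides of [key] are [L (phi X h)] and
   [phi Y (L h)]. *)
pose x : copies 2 H := copies_inj 0 h.
have key : shear L (diag2 (phi X) (phi Y) x) = diag2 (phi X) (phi Y) (shear L x).
  have : phi (exist _ W (mem_set Wball)) (u' x) = phi (exist _ W (mem_set Wball)) (u' x) by [].
  rewrite {1}W1 W2 => [|i].
    rewrite /conj_diag2 !bounded_op_compE u'K => /(can_inj u'K) ->.
    by rewrite shearVK.
  (* The condition left open in [W2]: conjugation by [s] gives the same [W], because [shear L]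
     commutes with the direct sum of [X] and [Y]. *)
  apply/bounded_op_eqP => y; rewrite /conj_diag2 !bounded_op_compE.
  congr (u' _); apply: copies2P; rewrite !(shearE, diag2E) //.
  by rewrite [(- L) _]/(- L _) LXY raddfD addKr.
have := congr1 (fun z : copies 2 H => z 1) key.
by rewrite !(shearE, diag2E) /= raddf0 !addr0.
Qed.

End Intertwining.

(** * Ampliations and approximation by elements of [Alg Z] *)

Section Ampliation.
Context {R : realType} {H : hilbertType R} (n : nat).

Definition ampliation (T : 'B(H)) : 'B(copies n H) :=
  op_matrix (\matrix_(i < n, j < n) if i == j then T else 0).

Lemma ampliationE T y k : ampliation T y k = T (y k).
Proof.
rewrite /= (bigD1 k) //= mxE eqxx big1 ?addr0 // => j jk.
by rewrite mxE eq_sym (negbTE jk).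
Qed.

End Ampliation.

Section Algebra.
Context {R : realType} {H : hilbertType R} {d : nat}.
Variable Z : 'I_d -> 'B(H).

Lemma AlgZ_gen i : Alg Z (Z i).
Proof. by move=> A [_]; apply; exists i. Qed.

Lemma Alg1 : Alg Z 1.
Proof. by move=> A [[]]. Qed.

Lemma AlgP c S T : Alg Z S -> Alg Z T -> Alg Z (c *: S + T).
Proof.
by move=> AS AT A ZA; have [[_ AP _] _] := ZA; apply: AP; [exact: AS|exact: AT].
Qed.

Lemma AlgM S T : Alg Z S -> Alg Z T -> Alg Z (S * T).
Proof.
by move=> AS AT A ZA; have [[_ _ AM] _] := ZA; apply: AM; [exact: AS|exact: AT].
Qed.

Lemma Alg0 : Alg Z 0.
Proof. by rewrite -[0](addNr 1) -scaleN1r; apply: AlgP; exact: Alg1. Qed.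

Lemma Alg_word (w : seq 'I_d) : Alg Z (\prod_(i <- w) Z i).
Proof.
elim/big_ind: _ => [|S T|i _]; [exact: Alg1|exact: AlgM|exact: AlgZ_gen].
Qed.

(** The closure of the orbit of [x] under [Alg Z], read in the slots of [D] only and with one [S]
    for all of them. The restriction to [D] allows slot 0 to hold unrelated vectors. *)
Definition approx_set n (D : {pred 'I_n}) (x : copies n H) : set (copies n H) :=
  [set y | forall e, 0 < e ->
    exists2 S : 'B(H), Alg Z S & forall k, k \in D -> `|y k - S (x k)| < e].

Lemma closed_approx_set n (D : {pred 'I_n}) x : closed (approx_set D x).
Proof.
move=> y yc e e0; have e2 : 0 < e / 2 by rewrite divr_gt0.
have [y' [y'A]] := yc _ (nbhsx_ballx y _ e2); have [S AS Sy'] := y'A _ e2.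
rewrite -ball_normE /= => yy'; exists S => // k kD.
rewrite -(subrK (y' k) (y k)) -addrA (splitr e) (le_lt_trans (ler_normD _ _)) //.
by rewrite ltrD ?Sy' // (le_lt_trans (copies_coord_le (y - y') k)).
Qed.

Lemma submod_approx_set n (D : {pred 'I_n}) x : submod (approx_set D x).
Proof.
split=> [e e0|a y z yA zA e e0].
  exists 0; first exact: Alg0.
  by move=> k _; rewrite [X in `|X - _|]/(0 : H) [X in `|_ - X|]/(0 : H) subr0 normr0.
(* Adding 1 keeps the divisor positive when [a = 0]. *)
have a1 : 0 < `|a| + 1 by rewrite ltr_wpDl.
have e1 : 0 < e / 2 / (`|a| + 1) by rewrite !divr_gt0.
have e2 : 0 < e / 2 by rewrite divr_gt0.
have [S AS Sy] := yA _ e1; have [T AT Tz] := zA _ e2.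
exists (a *: S + T); first exact: AlgP.
move=> k kD.
have -> : (a *: y + z) k - (a *: S + T) (x k) = a *: (y k - S (x k)) + (z k - T (x k)).
  rewrite [X in X - _]/(a *: y k + z k) [X in _ - X]/(a *: S (x k) + T (x k)).
  by rewrite scalerBr opprD addrACA.
rewrite (splitr e) (le_lt_trans (ler_normD _ _)) // ler_ltD ?Tz // normrZ.
apply: (@le_trans _ _ ((`|a| + 1) * (e / 2 / (`|a| + 1)))); last first.
  by rewrite mulrC divfK // gt_eqF.
by apply: ler_pM => //; [rewrite lerDl|rewrite ltW // Sy].
Qed.

End Algebra.

(** * From strong approximation to the weak operator topology *)

Section WeaklyAlgebraic.
Context {R : realType} {H : hilbertType R}.

(** [G] is generated by the traces on [A] of the strong neighbourhoods of [T]. Along it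
    [inner (S x) y] tends to [inner (T x) y] by Cauchy-Schwarz, so it converges to [T] weakly. *)
Lemma wot_closure_approx (A : set 'B(H)) (T : 'B(H)) :
    (forall (l : seq H) (e : R[i]), 0 < e ->
      exists2 S, A S & forall x, x \in l -> `|T x - S x| < e) ->
  wot_closure A T.
Proof.
move=> approx.
pose G : set_system 'B(H) := [set B | exists l : seq H, exists2 e : R[i], 0 < e &
  forall S, A S -> (forall x, x \in l -> `|T x - S x| < e) -> B S].
have GP : ProperFilter G.
  split=> [[l [e e0 /= le]]|].
    by have [S AS Sl] := approx l e e0; exact: (le S).
  split.
  - by exists [::], 1.
  - move=> B C [l [e e0 lB]] [l' [e' e'0 lC]].
    (* The order of [R[i]] is partial, but positive elements are real and hence comparable. *)
    have ee' : e >=< e' by rewrite real_comparable ?gtr0_real.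
    exists (l ++ l'), (Num.min e e'); first by rewrite comparable_lt_min // e0.
    move=> S AS Sl; split; [apply: lB => // x xl|apply: lC => // x xl].
      apply: lt_le_trans (Sl x _) _; first by rewrite mem_cat xl.
      by rewrite comparable_ge_min // lexx.
    apply: lt_le_trans (Sl x _) _; first by rewrite mem_cat xl orbT.
    by rewrite comparable_ge_min // lexx orbT.
  - move=> B C BC [l [e e0 lB]]; exists l, e => // S AS Sl.
    by apply: BC; exact: lB.
rewrite /wot_closure closureEcvg; exists G => //; split; last first.
  by move=> B AB; exists [::], 1 => // S AS _; exact: AB.
pose F (S : 'B(H)) : {ptws H * H -> R[i]^o} := fun u => inner (S u.1) u.2.
have GF : F @ G --> F T.
  apply/pointwise_cvgP => -[x y].
  apply/cvgrPdist_lt => e e0.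
  have y1 : 0 < `|y| + 1 by rewrite ltr_wpDl.
  exists [:: x], (e / (`|y| + 1)); first by rewrite divr_gt0.
  move=> S AS /(_ x); rewrite inE eqxx => /(_ isT) Sx.
  rewrite /F /= -innerBl (le_lt_trans (CauchySchwarz_inner _ _)) //.
  apply: (@le_lt_trans _ _ (`|T x - S x| * (`|y| + 1))).
    by rewrite ler_wpM2l // lerDl.
  by rewrite -ltr_pdivlMr.
move=> B [_ [[C Cop <-] CT CB]].
by apply: filterS CB _; apply: GF; rewrite nbhsE; exists C.
Qed.

End WeaklyAlgebraic.

(** * Compression of [Z] to an invariant subspace and approximation of [phi Z] *)

Theorem theorem1p3 (R : realType) (H : hilbertType R)
    (H_separable : separable H) (H_infinite : infinite_dimensional H)
    (d m n : nat) (d_gt0 : (0 < d)%N) (m_gt0 : (0 < m)%N) (n_gt0 : (0 < n)%N)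
    (delta : 'M[nc_poly R[i] d]_(m, n)) (phi : nc_ball H delta -> 'B(H)) :
  operator_nc phi ->
  forall Z : nc_ball H delta, wot_closure (Alg (val Z)) (phi Z).
Proof.
move=> nc Z; apply: wot_closure_approx => l e e0.
have [q q_total] := separable_total_seq H_separable.
have [u [u' [uK u'K uiso]]] := unitary_copies H_infinite q_total (ltn0Sn 1).
(* Slot 0 of [x] holds 0 and slot [i.+1] holds the entry of [l] at index [i]. *)
pose x : copies (size l).+1 H := fun k => nth 0 (0 :: l) k.
pose g (t : seq 'I_d + nat) : copies (size l).+1 H :=
  match t with
  | inl w => ampliation _ (\prod_(i <- w) val Z i) x
  | inr j => copies_inj ord0 (q j)
  end.
have g_inj h : closed_span (range g) (copies_inj ord0 h).
  apply: closed_span_op (q_total h) => _ [j _ <-].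
  by apply: sub_closed_span; exists (inr j).
have [|V [W [VK Viso Vg VW]]] :=
    @isometry_onto _ _ H_infinite _ q_total (copies (size l).+1 H) _ g (copies_proj ord0).
  by move=> h; exists (copies_inj ord0 h); [exact: g_inj|exact: copies_injK].
pose A i : 'B(copies (size l).+1 H) := ampliation _ (val Z i).
(* A word is mapped to the word with the letter [i] prepended, and a vector in slot 0 stays in slot
   0. *)
have Ag i y : closed_span (range g) y -> closed_span (range g) (A i y).
  apply: closed_span_op => _ [[w|j] _ <-].
    apply: sub_closed_span; exists (inl (i :: w)) => //.
    apply/funext => k; rewrite -[LHS]/(ampliation _ _ x k) /A !ampliationE big_cons.
    by rewrite -[g _ k]/(ampliation _ _ x k) ampliationE.
  suff -> : A i (copies_inj ord0 (q j)) = copies_inj ord0 (val Z i (q j)) by exact: g_inj.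
  apply/funext => k; rewrite ampliationE !copies_injE.
  by case: ifP => // _; rewrite raddf0.
pose X i : 'B(H) := bounded_op_comp W (bounded_op_comp (A i) V).
(* [V] after [W] is the identity on the closed span, which [A i] preserves. *)
have VX i h k : V (X i h) k = val Z i (V h k).
  by rewrite !bounded_op_compE VW ?ampliationE //; exact: Ag (Vg h).
have Xball : nc_ball H delta X.
  apply: (@nc_ball_restrict _ _ _ _ _ delta _ V X (fun=> val Z)) => // k.
  exact: set_valP.
pose X' : nc_ball H delta := exist _ X (mem_set Xball).
have phiV h k : V (phi X' h) k = phi Z (V h k).
  pose Vk : 'B(H) := bounded_op_comp (copies_proj k) V.
  apply: (operator_nc_intertwine (X := X') (L := Vk) nc uK u'K uiso).
  by move=> i y; exact: VX.
(* The empty word gives [x] itself. *)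
have xg : closed_span (range g) x.
  apply: sub_closed_span; exists (inl [::]) => //.
  by apply/funext => k; rewrite -[LHS]/(ampliation _ _ x k) ampliationE big_nil.
(* Off slot 0, a word generator is exactly [S] applied to [x] for that word, and a slot 0 generator
   vanishes, so [S = 0] serves. *)
have sub : closed_span (range g) `<=` approx_set (val Z) [pred k | k != ord0] x.
  apply: closed_span_min; [exact: closed_approx_set|exact: submod_approx_set|].
  move=> _ [[w|j] _ <-] r r0.
    exists (\prod_(i <- w) val Z i); first exact: Alg_word.
    by move=> k _; rewrite [g _ k]ampliationE subrr normr0.
  exists 0; first exact: Alg0.
  move=> k; rewrite inE [g _ k]copies_injE => /negbTE ->.
  by rewrite [X in `|_ - X|]/(0 : H) subr0 normr0.
(* This vector of the closed span has slots [phi Z (x k)], by [phiV] and because [V (W x)] is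
   [x]. *)
have [S AS Sx] := sub _ (Vg (phi X' (W x))) e e0.
exists S => // y yl; have il : (index y l < size l)%N by rewrite index_mem.
have := Sx (lift ord0 (Ordinal il)) isT.
by rewrite phiV VW // [x _](_ : _ = y) // /x lift0 /= nth_index.
Qed.
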